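(* $\mathbf{SC}(1,1)=\mathbf{SC}'(1,1)$.
   Context: For an alphabet $V$, $V^+=V^*-\{\lambda\}$, and $\mathit{alph}(w)$ is the set of symbols occurring in $w$. A semi-conditional grammar of degree $(1,1)$ is a quadruple $G=(N,T,P,S)$ where $N$ and $T$ are disjoint finite alphabets of nonterminals and terminals, $V=N\cup T$, $S\in N$, and $P$ is a finite set of productions $(A\to x,\mathit{Per},\mathit{For})$ with $A\in N$, $x\in V^+$ (no erasing productions), $\mathit{Per},\mathit{For}\subseteq V$, $|\mathit{Per}|\le1$, $|\mathit{For}|\le1$. Its language is $L(G)=\{w\in T^*:S\Rightarrow^*w\}$. $\mathbf{SC}(1,1)$ is the family of languages generated by such grammars when the derivation step $uAv\Rightarrow uxv$ ($u,v\in V^*$) by $(A\to x,\mathit{Per},\mathit{For})$ requires $\mathit{Per}\subseteq\mathit{alph}(uAv)$ and $\mathit{alph}(uAv)\cap\mathit{For}=\emptyset$. $\mathbf{SC}'(1,1)$ is the family of languages generated by such grammars when the derivation step instead requires $\mathit{Per}\subseteq\mathit{alph}(uv)$ and $\mathit{alph}(uv)\cap\mathit{For}=\emptyset$. *)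

(* Defs.v *)
From mathcomp Require Import all_boot.
Set Implicit Arguments. Unset Strict Implicit. Unset Printing Implicit Defensive.

(* A production (A -> x, Per, For) with |Per| <= 1, |For| <= 1,
   encoded as options (None = empty set). *)
Record production := Prod {
  p_lhs : nat; p_rhs : seq nat; p_per : option nat; p_for : option nat }.

Record sc_grammar := SCGrammar {
  g_N : seq nat; g_T : seq nat; g_P : seq production; g_S : nat }.

(* list membership for productions (no eqType needed) *)
Fixpoint has_prod (p : production) (s : seq production) : Prop :=
  if s is q :: s' then p = q \/ has_prod p s' else False.

Definition in_opt (o : option nat) (s : seq nat) : bool :=
  if o is Some a then a \in s else true.
Definition out_opt (o : option nat) (s : seq nat) : bool :=
  if o is Some a then a \notin s else true.

Definition g_V (G : sc_grammar) : seq nat := g_N G ++ g_T G.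

Definition wf_grammar (G : sc_grammar) : Prop :=
  [/\ forall a, a \in g_N G -> a \notin g_T G,
      g_S G \in g_N G &
      forall p, has_prod p (g_P G) ->
        [/\ p_lhs p \in g_N G, p_rhs p != [::],
            all (fun a => a \in g_V G) (p_rhs p),
            in_opt (p_per p) (g_V G) & in_opt (p_for p) (g_V G)]].

Definition step (primed : bool) (G : sc_grammar) (w w' : seq nat) : Prop :=
  exists p u v, [/\ has_prod p (g_P G),
    w = u ++ p_lhs p :: v, w' = u ++ p_rhs p ++ v &
    let ctx := if primed then u ++ v else w in
    in_opt (p_per p) ctx && out_opt (p_for p) ctx].

Inductive derives (primed : bool) (G : sc_grammar) : seq nat -> seq nat -> Prop :=
  | der_refl w : derives primed G w w
  | der_step w1 w2 w3 : step primed G w1 w2 -> derives primed G w2 w3 ->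
      derives primed G w1 w3.

Definition lang (primed : bool) (G : sc_grammar) (w : seq nat) : Prop :=
  all (fun a => a \in g_T G) w /\ derives primed G [:: g_S G] w.

Definition in_family (primed : bool) (L : seq nat -> Prop) : Prop :=
  exists G, wf_grammar G /\ forall w, L w <-> lang primed G w.

Definition SC11 := in_family false.
Definition SC'11 := in_family true.

(* Main.v *)
Require Import Defs.
From Stdlib Require Import Setoid.
From mathcomp Require Import all_boot.
Set Implicit Arguments. Unset Strict Implicit. Unset Printing Implicit Defensive.

(** The two step relations differ only on whether the rewritten symbol A itself
    counts as context, so a production of an SC(1,1) grammar whose conditions do
    not mention A is also correct in the primed sense; if A is forbidden the
    production is never applicable, and if A is required the condition is void.

    Conversely, given a primed grammar, keep exactly one symbol X of the sentential
    form hatted and let only the hatted symbol be rewritten, the first symbol of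
    the right-hand side inheriting the hat. A hatted symbol never occurs in a
    condition, so testing the whole form amounts to testing the context of the
    rewritten symbol. The hat moves from X to an occurrence of B by
      ^X -> L(X,B),   B -> R(X,B) (L(X,B) present, R(X,B) absent),
      L(X,B) -> X (R(X,B) present),   R(X,B) -> ^B (L(X,B) absent).
    These tests guarantee that one and only one symbol receives the hat. *)

(** * Production lists, derivations and words with a distinguished symbol *)

Lemma has_prod_cat p s1 s2 :
  has_prod p (s1 ++ s2) <-> has_prod p s1 \/ has_prod p s2.
Proof. by elim: s1 => [|q s1 IH] /=; tauto. Qed.

Lemma has_prod_map f p s :
  has_prod p (map f s) <-> exists2 q, has_prod q s & p = f q.
Proof.
elim: s => [|q s IH] /=; first by split=> [|[]].
split=> [[->|/IH[r rs ->]]|[r [->|rs]]]; first by exists q; [left|].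
- by exists r; [right|].
- by move=> ->; left.
- by move=> pf; right; apply/IH; exists r.
Qed.

Lemma has_prod_filter a p s : has_prod p (filter a s) <-> has_prod p s /\ a p.
Proof.
elim: s => [|q s IH] /=; first by split=> [|[]].
case: ifP => aq /=; split=> [|[]].
- by case=> [->|] /=; [split; [left|] | case/IH=> ? ?; split; [right|]].
- by case=> [->|sp ap]; [left | right; apply/IH].
- by move/IH=> [? ?]; split=> //; right.
- by case=> [->|sp ap]; [rewrite aq | apply/IH].
Qed.

Lemma has_prod_flatten (I : eqType) (f : I -> seq production) p s :
  has_prod p (flatten (map f s)) <-> exists2 i, i \in s & has_prod p (f i).
Proof.
elim: s => [|i s IH] /=; first by split=> [|[]].
rewrite has_prod_cat IH; split=> [[fi|[j js fj]]|[j]].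
- by exists i; rewrite ?mem_head.
- by exists j; rewrite // in_cons js orbT.
- by rewrite in_cons => /orP[/eqP->|js fj]; [left | right; exists j].
Qed.

Lemma derives_sub b1 b2 G1 G2 :
  (forall w w', step b1 G1 w w' -> step b2 G2 w w') ->
  forall w w', derives b1 G1 w w' -> derives b2 G2 w w'.
Proof.
move=> sub w w'; elim=> [z|z1 z2 z3 /sub s _]; first exact: der_refl.
exact: der_step.
Qed.

Lemma derives_trans b G w1 w2 w3 :
  derives b G w1 w2 -> derives b G w2 w3 -> derives b G w1 w3.
Proof. by elim=> // z1 z2 z3 s _ IH /IH; apply: der_step. Qed.

Lemma derives1 b G w1 w2 : step b G w1 w2 -> derives b G w1 w2.
Proof. by move=> s; apply: der_step s (der_refl _ _ _). Qed.

Lemma mem_cat_cons_neq (T : eqType) (a b : T) u v :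
  a != b -> (a \in u ++ b :: v) = (a \in u ++ v).
Proof. by move=> /negPf ab; rewrite !mem_cat in_cons ab. Qed.

Lemma mem_mid (T : eqType) (a : T) u v : a \in u ++ a :: v.
Proof. by rewrite mem_cat mem_head orbT. Qed.

(** * From SC(1,1) to SC'(1,1): removing conditions on the rewritten symbol *)

Section Unprime.

Variable G : sc_grammar.

Definition void_per (p : production) : production :=
  Prod (p_lhs p) (p_rhs p)
    (if p_per p == Some (p_lhs p) then None else p_per p) (p_for p).

Definition unprime : sc_grammar :=
  SCGrammar (g_N G) (g_T G)
    [seq void_per p | p <- g_P G & p_for p != Some (p_lhs p)] (g_S G).

Lemma unprime_wf : wf_grammar G -> wf_grammar unprime.
Proof.
move=> [NT SN wfP]; split=> // p /has_prod_map[q /has_prod_filter[/wfP[? ? ? per ?] _] ->].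
by split=> //=; case: ifP.
Qed.

(** The whole form differs from the context only by the left-hand side: forbidding it is excluded by
    hypothesis, and requiring it is satisfied automatically. *)
Lemma void_per_cond p u v : p_for p != Some (p_lhs p) ->
  in_opt (p_per (void_per p)) (u ++ v) && out_opt (p_for p) (u ++ v) =
  in_opt (p_per p) (u ++ p_lhs p :: v) && out_opt (p_for p) (u ++ p_lhs p :: v).
Proof.
case: p => A x per fo /= foA; congr andb.
  case: eqP => [-> /=|]; first by rewrite mem_mid.
  by case: per => //= a neq; rewrite mem_cat_cons_neq //; apply/eqP => E; apply: neq; rewrite E.
by case: fo foA => //= a neq; rewrite mem_cat_cons_neq.
Qed.

Lemma unprime_step w w' : step false G w w' <-> step true unprime w w'.
Proof.
split=> [[p [u [v [Pp -> -> /= c]]]]|[q [u [v [/has_prod_map[p /has_prod_filter[Pp fo] ->] -> -> /= c]]]]].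
  have fo : p_for p != Some (p_lhs p).
    apply/eqP => E; move: c; by rewrite E /= mem_mid andbF.
  exists (void_per p), u, v; split=> //.
    by apply/has_prod_map; exists p => //; apply/has_prod_filter.
  by rewrite /= void_per_cond.
by exists p, u, v; split=> //; rewrite /= -void_per_cond.
Qed.

Lemma unprime_lang w : lang false G w <-> lang true unprime w.
Proof.
by split=> -[wT der]; split=> //; apply: derives_sub der => z z' /unprime_step.
Qed.

End Unprime.

(** Serves to compare the position of the hat with that of the symbol to be rewritten. *)
Lemma cat_cons_eq (T : Type) (u v s t : seq T) a b :
  u ++ a :: v = s ++ b :: t ->
  [\/ [/\ u = s, a = b & v = t],
      exists r, s = u ++ a :: r /\ v = r ++ b :: t |
      exists r, u = s ++ b :: r /\ t = r ++ a :: v].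
Proof.
elim: u s => [|c u IH] [|d s] /=.
- by move=> [-> ->]; constructor 1.
- by move=> [-> ->]; constructor 2; exists s.
- by move=> [-> <-]; constructor 3; exists u.
move=> [-> /IH[[-> -> ->]|[r [-> ->]]|[r [-> ->]]]].
- by constructor 1.
- by constructor 2; exists r.
- by constructor 3; exists r.
Qed.

(** * From SC'(1,1) to SC(1,1): coding of marks and the hatted grammar *)

Section Prime.

Variable G : sc_grammar.
Hypothesis wfG : wf_grammar G.

Let V := g_V G.
(** An element of a list is at most its sum, so all codes from [M] on are fresh. *)
Let M := (sumn V).+1.

Definition mark (k X B : nat) : nat := M + pickle (k, X, B).
(* Marked symbols are coded above every symbol of G; the hatted X, L(X,B) and
   R(X,B) are [hat X], [lv X B] and [ar X B]. *)
Definition hat X := mark 0 X 0.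
Definition lv X B := mark 1 X B.
Definition ar X B := mark 2 X B.

(** R(X,B) stands where B stood, the other marks where X stood; hence moving the hat is invisible
    after unmarking. *)
Definition unmark (a : nat) : nat :=
  if a < M then a else
  if @unpickle (nat * nat * nat)%type (a - M) is Some (k, X, B)
  then if k == 2 then B else X else a.

Lemma V_lt a : a \in V -> a < M.
Proof.
rewrite /M; elim: V => //= b s IH; rewrite in_cons => /orP[/eqP->|/IH].
  by rewrite ltnS leq_addr.
by rewrite !ltnS => /leq_trans; apply; rewrite leq_addl.
Qed.

Lemma N_V a : a \in g_N G -> a \in V.
Proof. by rewrite mem_cat => ->. Qed.

Lemma T_V a : a \in g_T G -> a \in V.
Proof. by rewrite mem_cat orbC => ->. Qed.

Lemma eq_mark k X B k' X' B' :
  (mark k X B == mark k' X' B') = [&& k == k', X == X' & B == B'].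
Proof. by rewrite eqn_add2l (inj_eq (pcan_inj pickleK)) -!pair_eqE /= andbA. Qed.

Lemma mark_ge k X B : M <= mark k X B.
Proof. exact: leq_addr. Qed.

Lemma unmark_mark k X B : unmark (mark k X B) = if k == 2 then B else X.
Proof. by rewrite /unmark ltnNge mark_ge /= /mark addKn pickleK. Qed.

Lemma unmark_V a : a \in V -> unmark a = a.
Proof. by rewrite /unmark => /V_lt ->. Qed.

Lemma mark_notinV k X B s : all (mem V) s -> mark k X B \notin s.
Proof.
by move/allP=> sV; apply/negP => /sV /V_lt; rewrite ltnNge mark_ge.
Qed.

Lemma neq_mark a k X B : a \in V -> a != mark k X B.
Proof. by move=> aV; apply: contraTneq aV => ->; apply/negP => /V_lt; rewrite ltnNge mark_ge. Qed.

Definition marks := filter (leq M).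

Lemma marks_V s : all (mem V) s -> marks s = [::].
Proof.
move=> /allP sV; apply/eqP; rewrite -[_ == _]negbK -has_filter; apply/hasPn => a /sV /V_lt.
by rewrite ltnNge.
Qed.

Lemma unmark_id s : marks s = [::] -> map unmark s = s.
Proof.
by elim: s => //= a s IH; rewrite /unmark; case: ltnP => //= _ /IH ->.
Qed.

Lemma map_unmark_V s : all (mem V) s -> map unmark s = s.
Proof. by move/marks_V/unmark_id. Qed.

Lemma mem_marks k X B s : (mark k X B \in marks s) = (mark k X B \in s).
Proof. by rewrite mem_filter mark_ge. Qed.

Lemma marks_cat u v : marks (u ++ v) = marks u ++ marks v.
Proof. exact: filter_cat. Qed.

Definition jump_prods (XB : nat * nat) : seq production :=
  let: (X, B) := XB in
  [:: Prod (hat X) [:: lv X B] None None;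
      Prod B [:: ar X B] (Some (lv X B)) (Some (ar X B));
      Prod (lv X B) [:: X] (Some (ar X B)) None;
      Prod (ar X B) [:: hat B] None (Some (lv X B))].

(** The default 0 of [head] is never reached for productions of [G], since these do not erase. *)
Definition hat_prod (p : production) : production :=
  Prod (hat (p_lhs p)) (hat (head 0 (p_rhs p)) :: behead (p_rhs p))
    (p_per p) (p_for p).

(** X may be a terminal, because a right-hand side may start with one and the hat must be able to
    leave it; the target B is about to be rewritten, hence a nonterminal. *)
Let VN := [seq (X, B) | X <- V, B <- g_N G].

(** The unconditional productions from [hat X] to X end a derivation: every production rewrites a
    mark or requires some L(X,B), so a form without marks is stuck. *)
Definition prime : sc_grammar :=
  SCGrammar
    (g_N G ++ map hat V ++ [seq lv XB.1 XB.2 | XB <- VN]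
           ++ [seq ar XB.1 XB.2 | XB <- VN])
    (g_T G)
    (flatten (map jump_prods VN) ++
     flatten [seq [:: Prod (hat X) [:: X] None None] | X <- V] ++
     map hat_prod (g_P G))
    (hat (g_S G)).

Lemma VNP X B : reflect (X \in V /\ B \in g_N G) ((X, B) \in VN).
Proof.
apply: (iffP allpairsP) => [[[x y] [/= ? ? [-> ->]]]|[? ?]] //.
by exists (X, B).
Qed.

Lemma prime_prodP p : has_prod p (g_P prime) <->
  [\/ exists X B, [/\ X \in V, B \in g_N G & has_prod p (jump_prods (X, B))],
      exists2 X, X \in V & p = Prod (hat X) [:: X] None None |
      exists2 q, has_prod q (g_P G) & p = hat_prod q].
Proof.
rewrite /= !has_prod_cat !has_prod_flatten has_prod_map; split.
  case=> [[[X B] /VNP[XV BN] h]|[[X XV /= [->|//]]|h]].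
  - by constructor 1; exists X, B.
  - by constructor 2; exists X.
  - by constructor 3.
case=> [[X [B [XV BN h]]]|[X XV ->]|h]; last by tauto.
  by left; exists (X, B) => //; apply/VNP.
by right; left; exists X => //; left.
Qed.

Lemma rhs_cons p : has_prod p (g_P G) -> exists y ys,
  [/\ p_rhs p = y :: ys, y \in V & all (mem V) ys].
Proof.
case: wfG => _ _ h /h[_]; case: (p_rhs p) => // y ys _ /= /andP[yV ysV] _ _.
by exists y, ys.
Qed.

(** Conditions of [G] name symbols of [V] only, and a hat is not one of them. *)
Lemma hat_prod_cond p u v : has_prod p (g_P G) ->
  in_opt (p_per p) (u ++ hat (p_lhs p) :: v) &&
    out_opt (p_for p) (u ++ hat (p_lhs p) :: v) =
  in_opt (p_per p) (u ++ v) && out_opt (p_for p) (u ++ v).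
Proof.
case: wfG => _ _ h /h[_ _ _]; case: p => A x [a|] [b|] /= aV bV;
  by rewrite ?mem_cat_cons_neq ?neq_mark.
Qed.

Lemma prime_wf : wf_grammar prime.
Proof.
case: (wfG) => NT SN wfP.
have sub a : a \in V -> a \in g_V prime.
  by rewrite !mem_cat => /orP[->|->]; rewrite ?orbT.
have subo o : in_opt o V -> in_opt o (g_V prime) by case: o => //= a /sub.
have hatN X : X \in V -> hat X \in g_N prime.
  by move=> XV; rewrite !mem_cat map_f ?orbT.
have lvN X B : X \in V -> B \in g_N G -> lv X B \in g_N prime.
  move=> XV BN; rewrite !mem_cat; apply/orP; right; apply/orP; right; apply/orP; left.
  by apply/mapP; exists (X, B) => //; apply/VNP.
have arN X B : X \in V -> B \in g_N G -> ar X B \in g_N prime.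
  move=> XV BN; rewrite !mem_cat; do 3 (apply/orP; right).
  by apply/mapP; exists (X, B) => //; apply/VNP.
have NV a : a \in g_N prime -> a \in g_V prime by rewrite [in X in _ -> X]mem_cat => ->.
split=> [a|| p /prime_prodP[[X [B [XV BN h]]]|[X XV ->]|[q Pq ->]]] /=.
- rewrite mem_cat => /orP[/NT//|ha]; apply/negP => /T_V/V_lt; apply/negP.
  rewrite -leqNgt; move: ha; rewrite !mem_cat.
  by case/or3P=> /mapP[? _ ->]; apply: mark_ge.
- by apply: hatN; apply: N_V.
- have BV := N_V BN.
  case: h => [->|[->|[->|[->|//]]]] /=; split=> //=; rewrite ?andbT; auto.
    by rewrite mem_cat BN.
- by split=> //=; rewrite ?andbT; auto.
- have [y [ys [E yV ysV]]] := rhs_cons Pq; have [AN _ _ per fo] := wfP _ Pq.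
  split; rewrite /= ?E /=; auto.
    by apply: hatN; apply: N_V.
  rewrite NV ?hatN //=; apply/allP => a /(allP ysV); exact: sub.
Qed.

(* The five stages of a hat move; the empty list of marks is a form that has lost
   its hat for good. *)
Definition hatted (z : seq nat) : Prop := exists X B, exists2 st,
  st \in [:: [::]; [:: hat X]; [:: lv X B]; [:: lv X B; ar X B]; [:: ar X B]] &
  perm_eq (marks z) st.

(** * Soundness: reading marked derivations back in [G] *)

Lemma hatted_hat z X : hatted z -> hat X \in z -> perm_eq (marks z) [:: hat X].
Proof.
move=> [X' [B' [st st5 zst]]]; rewrite -mem_marks (perm_mem zst).
move: st5; rewrite !inE => /orP[|/or4P[]] /eqP E; move: zst; rewrite E // !inE ?eq_mark //=.
by rewrite andbT => zst /eqP->.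
Qed.

Lemma hatted_lv z X B : hatted z -> lv X B \in z ->
  perm_eq (marks z) [:: lv X B] \/ perm_eq (marks z) [:: lv X B; ar X B].
Proof.
move=> [X' [B' [st st5 zst]]]; rewrite -mem_marks (perm_mem zst).
move: st5; rewrite !inE => /orP[|/or4P[]] /eqP E; move: zst;
  rewrite E // !inE ?eq_mark //= ?orbF => zst /andP[/eqP-> /eqP->]; by [left | right].
Qed.

Lemma hatted_ar z X B : hatted z -> ar X B \in z ->
  perm_eq (marks z) [:: lv X B; ar X B] \/ perm_eq (marks z) [:: ar X B].
Proof.
move=> [X' [B' [st st5 zst]]]; rewrite -mem_marks (perm_mem zst).
move: st5; rewrite !inE => /orP[|/or4P[]] /eqP E; move: zst;
  rewrite E // !inE ?eq_mark //= => zst /andP[/eqP-> /eqP->]; by [left | right].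
Qed.

Lemma marks_cons_mark u k X B v :
  perm_eq (marks (u ++ mark k X B :: v)) (mark k X B :: marks (u ++ v)).
Proof. by rewrite !marks_cat /= mark_ge perm_catC /= perm_cons perm_catC. Qed.

Lemma marks_cons_V u a v : a \in V -> marks (u ++ a :: v) = marks (u ++ v).
Proof. by move=> /V_lt aM; rewrite !marks_cat /= leqNgt aM. Qed.

Lemma perm_mark_rest u k X B v st :
  perm_eq (marks (u ++ mark k X B :: v)) (mark k X B :: st) ->
  perm_eq (marks (u ++ v)) st.
Proof. by rewrite (permPl (marks_cons_mark _ _ _ _ _)) perm_cons. Qed.

(** The mark that is rewritten or required leaves at most two possible stages, and the conditions
    decide between them. Only [hat_prod] changes the unmarked form. *)
Lemma hatted_step z z' : hatted z -> step false prime z z' ->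
  hatted z' /\
  (map unmark z = map unmark z' \/ step true G (map unmark z) (map unmark z')).
Proof.
move=> hz [p [u [v [/prime_prodP Pp zE z'E /= c]]]]; subst z z'.
case: Pp c hz => [[X [B [XV BN [->|[->|[->|[->|//]]]]]]]|[X XV ->]|[q Pq ->]] /= c hz.
- split; last by left; rewrite !map_cat /= !unmark_mark.
  have /perm_mark_rest r := hatted_hat hz (mem_mid _ _ _).
  exists X, B, [:: lv X B]; first by rewrite !inE eqxx ?orbT.
  by rewrite (permPl (marks_cons_mark _ _ _ _ _)) perm_cons.
- have BV := N_V BN; case/andP: c => c1 c2.
  split; last by left; rewrite !map_cat /= unmark_mark unmark_V.
  (* The forbidden R(X,B) excludes the stage with two marks, so no second symbol can be chosen as
     target. *)
  have r : perm_eq (marks (u ++ v)) [:: lv X B].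
    have [|m] := hatted_lv hz c1; first by rewrite marks_cons_V.
    by rewrite -mem_marks (perm_mem m) !inE eqxx orbT in c2.
  exists X, B, [:: lv X B; ar X B]; first by rewrite !inE eqxx ?orbT.
  by rewrite (permPl (marks_cons_mark _ _ _ _ _)) perm_sym (perm_catC [:: _] [:: _]) perm_cons perm_sym.
- rewrite andbT in c.
  split; last by left; rewrite !map_cat /= unmark_mark unmark_V.
  exists X, B, [:: ar X B]; first by rewrite !inE eqxx ?orbT.
  rewrite marks_cons_V //.
  (* L(X,B) alone is excluded, since R(X,B) is required. *)
  have [m|/perm_mark_rest//] := hatted_lv hz (mem_mid _ _ _).
  by move: c; rewrite -mem_marks (perm_mem m) inE eq_mark.
- split; last by left; rewrite !map_cat /= !unmark_mark.
  (* The second index is arbitrary, as this stage involves only one symbol. *)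
  exists B, B, [:: hat B]; first by rewrite !inE eqxx ?orbT.
  rewrite (permPl (marks_cons_mark _ _ _ _ _)) perm_cons.
  have [m|/perm_mark_rest//] := hatted_ar hz (mem_mid _ _ _).
  by move: c; rewrite -mem_marks (perm_mem m) inE eqxx.
- split; last by left; rewrite !map_cat /= unmark_mark unmark_V.
  exists X, X, [::] => //; rewrite marks_cons_V //.
  exact: perm_mark_rest (hatted_hat hz (mem_mid _ _ _)).
have [y [ys [E yV ysV]]] := rhs_cons Pq.
have /perm_mark_rest/perm_nilP r := hatted_hat hz (mem_mid _ _ _).
move: c; rewrite E /= => c; split.
  exists y, y, [:: hat y]; first by rewrite !inE eqxx orbT.
  rewrite (permPl (marks_cons_mark _ _ _ _ _)) perm_cons.
  by move: r; rewrite !marks_cat (marks_V ysV) /= => ->.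
right; exists q, (map unmark u), (map unmark v); split=> //.
- by rewrite map_cat /= unmark_mark.
- by rewrite E !map_cat /= map_cat unmark_mark /= (map_unmark_V ysV).
(* The hat was the only mark, so the context is literally the same in both grammars and the
   conditions transfer. *)
rewrite /= -map_cat (unmark_id r).
by move: c; rewrite hat_prod_cond.
Qed.

Lemma hatted_derives z z' : derives false prime z z' -> hatted z ->
  derives true G (map unmark z) (map unmark z').
Proof.
elim=> [w _|w1 w2 w3 s _ IH h1]; first exact: der_refl.
have [h2 [->|s']] := hatted_step h1 s; first exact: IH.
exact: der_step s' (IH h2).
Qed.

(** * Completeness: moving the hat to where it is needed *)

Section Jump.

Variables (u v : seq nat) (X B : nat).
Hypotheses (uV : all (mem V) u) (vV : all (mem V) v).
Hypotheses (XV : X \in V) (BN : B \in g_N G).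

Let jump_prod p : has_prod p (jump_prods (X, B)) -> has_prod p (g_P prime).
Proof. by move=> h; apply/prime_prodP; constructor 1; exists X, B. Qed.

(* The form [f a b] has [a] at the position of X and [b] at that of B; the
   abstraction covers both orders of the two positions. *)
Lemma jump (f : nat -> nat -> seq nat) :
    (forall b, exists s t, forall a, f a b = s ++ a :: t) ->
    (forall a, exists s t, forall b, f a b = s ++ b :: t) ->
    (forall a b c, (c \in f a b) = [|| c == a, c == b | c \in u ++ v]) ->
  derives false prime (f (hat X) B) (f X (hat B)).
Proof.
move=> f1 f2 mem_f.
have uvV : all (mem V) (u ++ v) by rewrite all_cat uV.
have BV := N_V BN.
have step1 A a b per fo : has_prod (Prod A [:: a] per fo) (g_P prime) ->
    in_opt per (f A b) -> out_opt fo (f A b) -> step false prime (f A b) (f a b).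
  move=> Pp cp cf; have [s [t E]] := f1 b.
  by exists (Prod A [:: a] per fo), s, t; rewrite -!E /= cp cf.
have step2 A a b per fo : has_prod (Prod A [:: b] per fo) (g_P prime) ->
    in_opt per (f a A) -> out_opt fo (f a A) -> step false prime (f a A) (f a b).
  move=> Pp cp cf; have [s [t E]] := f2 a.
  by exists (Prod A [:: b] per fo), s, t; rewrite -!E /= cp cf.
have nm k Y C a : a \in V -> (mark k Y C == a) = false.
  by move=> aV; rewrite eq_sym; apply/negbTE/neq_mark.
have nuv k Y C : (mark k Y C \in u ++ v) = false by apply/negbTE/mark_notinV.
(* The four productions of [jump_prods] are applied in order; as [u] and [v] carry no marks, the
   tests see only the two moving positions. *)
apply: (der_step (w2 := f (lv X B) B)).
  by apply: step1; [apply: jump_prod; left | |].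
apply: (der_step (w2 := f (lv X B) (ar X B))).
  apply: step2; first by apply: jump_prod; right; left.
    by rewrite /= mem_f eqxx.
  by rewrite /= mem_f eq_mark nm ?nuv.
apply: (der_step (w2 := f X (ar X B))).
  apply: step1; [by apply: jump_prod; right; right; left | | by []].
  by rewrite /= mem_f eqxx orbT.
apply/derives1/step2; [by apply: jump_prod; do 3 right; left | by [] |].
by rewrite /= mem_f eq_mark nm ?nuv.
Qed.

End Jump.

Lemma jump_to u X v s A t : all (mem V) (u ++ X :: v) -> A \in g_N G ->
  u ++ X :: v = s ++ A :: t ->
  derives false prime (u ++ hat X :: v) (s ++ hat A :: t).
Proof.
move=> wV AN E; have [[-> -> ->]|[r [-> vE]]|[r [uE ->]]] := cat_cons_eq E.
  exact: der_refl.
- move: wV; rewrite vE !all_cat /= all_cat /= => /and5P[uV XV rV _ tV].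
  rewrite -catA /=.
  apply: (@jump u (r ++ t) X A _ _ XV AN (fun a b => u ++ a :: r ++ b :: t)) => //.
  + by rewrite all_cat rV.
  + by move=> b; exists u, (r ++ b :: t).
  + by move=> a; exists (u ++ a :: r), t => b; rewrite -catA.
  + by move=> a b c; rewrite !(mem_cat, inE); do !case: (_ == _); do !case: (_ \in _).
- move: wV; rewrite uE !all_cat /= => /and3P[/and3P[sV _ rV] XV vV].
  rewrite -catA /=.
  apply: (@jump s (r ++ v) X A _ _ XV AN (fun a b => s ++ b :: r ++ a :: v)) => //.
  + by rewrite all_cat rV.
  + by move=> b; exists (s ++ b :: r), v => a; rewrite -catA.
  + by move=> a; exists s, (r ++ a :: v).
  + by move=> a b c; rewrite !(mem_cat, inE); do !case: (_ == _); do !case: (_ \in _).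
Qed.

(** The hat may start anywhere: before each step [jump_to] brings it to the symbol to be rewritten.
    This freedom makes the induction work, since a step leaves the hat on the first symbol of the
    right-hand side. *)
Lemma derives_hat w w' : derives true G w w' ->
  forall u X v, w = u ++ X :: v -> all (mem V) w ->
  exists u' X' v', [/\ w' = u' ++ X' :: v', all (mem V) w' &
    derives false prime (u ++ hat X :: v) (u' ++ hat X' :: v')].
Proof.
elim=> [w1|w1 w2 w3 [p [s [t [Pp w1E w2E /= c]]]] _ IH] u X v E wV.
  by exists u, X, v; split=> //; apply: der_refl.
have [y [ys [rE yV ysV]]] := rhs_cons Pp.
have [_ _ /(_ _ Pp)[AN _ _ _ _]] := wfG.
have stV : all (mem V) s /\ all (mem V) t.
  by move: wV; rewrite w1E all_cat /= => /and3P[].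
have w2V : all (mem V) w2.
  by case: stV => sV tV; rewrite w2E rE !all_cat /= sV yV ysV.
rewrite w2E rE /= in IH w2V.
have [u' [X' [v' [-> w3V der]]]] := IH _ _ _ erefl w2V.
exists u', X', v'; split=> //.
apply: derives_trans (jump_to _ AN _) _; [by rewrite -E | by rewrite -E; exact: w1E |].
apply: der_step der; exists (hat_prod p), s, t; split=> //.
- by apply/prime_prodP; constructor 3; exists p.
- by rewrite /= rE.
by rewrite /= hat_prod_cond.
Qed.

Lemma prime_lang w : lang true G w <-> lang false prime w.
Proof.
have [_ SN _] := wfG; have SV := N_V SN.
have TV : all (mem (g_T G)) w -> all (mem V) w by apply: sub_all => a /T_V.
split=> -[wT der]; split=> //.
  have SV' : all (mem V) [:: g_S G] by rewrite /= SV.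
  have [u [X [v [wE wV der']]]] := derives_hat der (erefl : _ = [::] ++ _ :: [::]) SV'.
  (* One last step removes the hat from wherever it ended. *)
  apply: derives_trans der' (derives1 _); rewrite wE.
  exists (Prod (hat X) [:: X] None None), u, v; split=> //.
  apply/prime_prodP; constructor 2; exists X => //.
  by move: wV; rewrite wE all_cat /= => /and3P[].
have hS : hatted [:: hat (g_S G)].
  exists (g_S G), (g_S G), [:: hat (g_S G)]; first by rewrite !inE eqxx orbT.
  by rewrite /= mark_ge.
have := hatted_derives der hS.
(* A terminal word carries no marks, so unmarking fixes it. *)
by rewrite /= unmark_mark /= map_unmark_V // TV.
Qed.

End Prime.

Theorem theorem2 : forall L : seq nat -> Prop, SC11 L <-> SC'11 L.
Proof.
move=> L; split=> -[G [wfG LG]].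
  exists (unprime G); split; first exact: unprime_wf.
  by move=> w; rewrite LG; apply: unprime_lang.
exists (prime G); split; first exact: prime_wf.
by move=> w; rewrite LG; apply: prime_lang.
Qed.
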